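(* The horizontal composition functor $\tilde\circ$ is associative under the canonical isomorphism of strict fiber products of three groupoids. Explicitly, let $\mathsf G,\mathsf H,\mathsf N,\mathsf M$ be groupoids. For full-morphisms $\mathsf A=(\psi,\mathsf I,\mathsf u):\mathsf G\rightharpoonup\mathsf H$, $\mathsf B=(\phi,\mathsf J,\mathsf v):\mathsf H\rightharpoonup\mathsf N$, $\mathsf C=(\varphi,\mathsf K,\mathsf w):\mathsf N\rightharpoonup\mathsf M$, the canonical isomorphism $(\mathsf I\stackrel{\circ}{\times}_{\mathsf H}\mathsf J)\stackrel{\circ}{\times}_{\mathsf N}\mathsf K\cong\mathsf I\stackrel{\circ}{\times}_{\mathsf H}(\mathsf J\stackrel{\circ}{\times}_{\mathsf N}\mathsf K)$ identifies the two iterated compositions of $\mathsf A,\mathsf B,\mathsf C$; and for arrows $\alpha_1\in\mathrm{FMor}^1(\mathsf G,\mathsf H)$, $\alpha_2\in\mathrm{FMor}^1(\mathsf H,\mathsf N)$, $\alpha_3\in\mathrm{FMor}^1(\mathsf N,\mathsf M)$, the arrows $(\alpha_3\,\tilde\circ\,\alpha_2)\,\tilde\circ\,\alpha_1$ and $\alpha_3\,\tilde\circ\,(\alpha_2\,\tilde\circ\,\alpha_1)$ coincide under the identifications of their sources and targets given by these canonical isomorphisms.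
   Context: A groupoid $\mathsf G=(G^1\rightrightarrows G^0)$ is a small category all of whose arrows are invertible; $G^1(a,b)$ is the set of arrows from $a$ to $b$. Composition is written from left to right: for $x\in G^1(a,b)$, $y\in G^1(b,c)$ one has $x\cdot y\in G^1(a,c)$. A strict morphism $\mathsf f=(f^0,f^1):\mathsf G\to\mathsf H$ is a functor. A natural transformation $\alpha:\mathsf f\Rightarrow\mathsf g$ is a map $\alpha:G^0\to H^1$ with $\alpha(a)\in H^1(f^0(a),g^0(a))$ and $f^1(x)\cdot\alpha(b)=\alpha(a)\cdot g^1(x)$ for $x\in G^1(a,b)$. A full-equivalence $\psi:\mathsf K\to\mathsf G$ is a strict morphism with $\psi^0$ surjective and $\psi^1:K^1(a,b)\to G^1(\psi^0(a),\psi^0(b))$ bijective for all $a,b\in K^0$; for $x:\psi^0(a)\to\psi^0(b)$ write $(\psi^1)^{-1}(x):a\to b$ for the unique preimage with the given source and target. Strict fiber product: for strict morphisms $\mathsf f_i:\mathsf G_i\to\mathsf H$, $i=1,2$, $\mathsf G_1\stackrel{\circ}{\times}_{\mathsf H}\mathsf G_2$ is the groupoid with objects $\{(a,b): f_1^0(a)=f_2^0(b)\}$ and arrows $\{(x,y): f_1^1(x)=f_2^1(y)\}$; $\tilde\pi_1,\tilde\pi_2$ are its projections. Given strict morphisms $\mathsf I\to\mathsf H\leftarrow\mathsf J\to\mathsf N\leftarrow\mathsf K$, the canonical isomorphism $(\mathsf I\stackrel{\circ}{\times}_{\mathsf H}\mathsf J)\stackrel{\circ}{\times}_{\mathsf N}\mathsf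 K\cong\mathsf I\stackrel{\circ}{\times}_{\mathsf H}(\mathsf J\stackrel{\circ}{\times}_{\mathsf N}\mathsf K)$ is the rebracketing $((i,j),k)\leftrightarrow(i,(j,k))$ on objects and on arrows. $\mathsf{FMor}(\mathsf G,\mathsf H)=(\mathrm{FMor}^1(\mathsf G,\mathsf H)\rightrightarrows\mathrm{FMor}^0(\mathsf G,\mathsf H))$ is the groupoid whose objects are full-morphisms $(\psi,\mathsf K,\mathsf u):\mathsf G\rightharpoonup\mathsf H$, i.e. pairs of strict morphisms $\mathsf G\xleftarrow{\psi}\mathsf K\xrightarrow{\mathsf u}\mathsf H$ with $\psi$ a full-equivalence; an arrow $(\psi_1,\mathsf K_1,\mathsf u_1)\to(\psi_2,\mathsf K_2,\mathsf u_2)$ is a natural transformation $\mathsf u_1\circ\tilde\pi_1\Rightarrow\mathsf u_2\circ\tilde\pi_2:\mathsf K_1\stackrel{\circ}{\times}_{\mathsf G}\mathsf K_2\to\mathsf H$. Composition of full-morphisms: the composition of $(\psi,\mathsf K,\mathsf u):\mathsf G\rightharpoonup\mathsf H$ with $(\phi,\mathsf L,\mathsf v):\mathsf H\rightharpoonup\mathsf N$ is $(\psi\circ\tilde\pi_1,\ \mathsf K\stackrel{\circ}{\times}_{\mathsf H}\mathsf L,\ \mathsf v\circ\tilde\pi_2):\mathsf G\rightharpoonup\mathsf N$, the strict fiber product being over $\mathsf u$ and $\phi$. Horizontal composition of arrows: let $\alpha:(\psi_1,\mathsf K_1,\mathsf u_1)\to(\psi_2,\mathsf K_2,\mathsf u_2)$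 in $\mathsf{FMor}(\mathsf G,\mathsf H)$ and $\beta:(\phi_1,\mathsf J_1,\mathsf v_1)\to(\phi_2,\mathsf J_2,\mathsf v_2)$ in $\mathsf{FMor}(\mathsf H,\mathsf N)$. An object of $(\mathsf K_1\stackrel{\circ}{\times}_{\mathsf H}\mathsf J_1)\stackrel{\circ}{\times}_{\mathsf G}(\mathsf K_2\stackrel{\circ}{\times}_{\mathsf H}\mathsf J_2)$ is $(k_1,j_1;k_2,j_2)$ with $u_1^0(k_1)=\phi_1^0(j_1)$, $u_2^0(k_2)=\phi_2^0(j_2)$, $\psi_1^0(k_1)=\psi_2^0(k_2)$, so $\alpha(k_1,k_2):\phi_1^0(j_1)\to\phi_2^0(j_2)$ in $H^1$. Choose $j_{1,2}\in J_2^0$ with $\phi_2^0(j_{1,2})=\phi_1^0(j_1)$ and $j_{2,1}\in J_1^0$ with $\phi_1^0(j_{2,1})=\phi_2^0(j_2)$, and let $x_\alpha=(\phi_1^1)^{-1}(\alpha(k_1,k_2)):j_1\to j_{2,1}$, $y_\alpha=(\phi_2^1)^{-1}(\alpha(k_1,k_2)):j_{1,2}\to j_2$. Then $(\beta\,\tilde\circ\,\alpha)(k_1,j_1;k_2,j_2):=\beta(j_1,j_{1,2})\cdot v_2^1(y_\alpha)=v_1^1(x_\alpha)\cdot\beta(j_{2,1},j_2)$ (independent of the choices). *)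

(* Defs.v *)
From mathcomp Require Import ssreflect ssrfun ssrbool boolp.

Set Implicit Arguments.
Unset Strict Implicit.
Unset Printing Implicit Defensive.

(* A small groupoid G^1 => G^0, with one set of arrows.  [comp x y e] is the
   left-to-right composite x . y, defined when e : tgt x = src y.  The laws are
   stated for all composability proofs at once. *)
Record groupoid := Groupoid {
  Ob : Type;
  Ar : Type;
  src : Ar -> Ob;
  tgt : Ar -> Ob;
  comp : forall x y : Ar, tgt x = src y -> Ar;
  unit_ar : Ob -> Ar;
  inv_ar : Ar -> Ar;
  src_comp : forall x y e, src (@comp x y e) = src x;
  tgt_comp : forall x y e, tgt (@comp x y e) = tgt y;
  src_unit : forall a, src (unit_ar a) = a;
  tgt_unit : forall a, tgt (unit_ar a) = a;
  src_inv : forall x, src (inv_ar x) = tgt x;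
  tgt_inv : forall x, tgt (inv_ar x) = src x;
  compA : forall x y z (exy : tgt x = src y) (eyz : tgt y = src z)
            (e : tgt (comp exy) = src z) (e' : tgt x = src (comp eyz)),
      comp e = comp e';
  comp1x : forall x (e : tgt (unit_ar (src x)) = src x), comp e = x;
  compx1 : forall x (e : tgt x = src (unit_ar (tgt x))), comp e = x;
  compxV : forall x (e : tgt x = src (inv_ar x)), comp e = unit_ar (src x);
  compVx : forall x (e : tgt (inv_ar x) = src x), comp e = unit_ar (tgt x)
}.
Arguments Ar : clear implicits.
Arguments Ob : clear implicits.
Arguments comp {g} x y e : rename.
Arguments unit_ar {g} a : rename.

Definition hom (G : groupoid) (a b : Ob G) : Type :=
  {x : Ar G | src x = a /\ tgt x = b}.

Lemma hom_eq (G : groupoid) (a b : Ob G) (x y : hom a b) :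
  sval x = sval y -> x = y.
Proof. by case: x y => [x px] [y py] /= exy; apply: eq_exist. Qed.

Record strict_mor (G H : groupoid) := StrictMor {
  ob_map :> Ob G -> Ob H;
  ar_map : Ar G -> Ar H;
  src_map : forall x, src (ar_map x) = ob_map (src x);
  tgt_map : forall x, tgt (ar_map x) = ob_map (tgt x);
  unit_map : forall a, ar_map (unit_ar a) = unit_ar (ob_map a);
  comp_map : forall x y (e : tgt x = src y)
               (e' : tgt (ar_map x) = src (ar_map y)),
      ar_map (comp x y e) = comp (ar_map x) (ar_map y) e'
}.

Definition smor_eq (G H : groupoid) (f g : strict_mor G H) : Prop :=
  f =1 g /\ ar_map f =1 ar_map g.

Section SmorId.
Variable G : groupoid.
Fact smor_id_comp (x y : Ar G) (e e' : tgt x = src y) :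
  comp x y e = comp x y e'.
Proof. by rewrite (Prop_irrelevance e e'). Qed.
Definition smor_id : strict_mor G G :=
  @StrictMor G G id id (fun=> erefl) (fun=> erefl) (fun=> erefl) smor_id_comp.
End SmorId.

Lemma comp_eq (G : groupoid) (x x' y y' : Ar G) (e : tgt x = src y)
  (e' : tgt x' = src y') : x = x' -> y = y' -> comp x y e = comp x' y' e'.
Proof. by move=> ex ey; subst x' y'; rewrite (Prop_irrelevance e e'). Qed.

Section SmorComp.
Variables (G H K : groupoid) (g : strict_mor H K) (f : strict_mor G H).
Let o a := g (f a).
Let r x := ar_map g (ar_map f x).
Fact smor_comp_src x : src (r x) = o (src x).
Proof. by rewrite /r !src_map. Qed.
Fact smor_comp_tgt x : tgt (r x) = o (tgt x).
Proof. by rewrite /r !tgt_map. Qed.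
Fact smor_comp_unit a : r (unit_ar a) = unit_ar (o a).
Proof. by rewrite /r !unit_map. Qed.
Fact smor_comp_comp x y (e : tgt x = src y) (e' : tgt (r x) = src (r y)) :
  r (comp x y e) = comp (r x) (r y) e'.
Proof.
have e1 : tgt (ar_map f x) = src (ar_map f y) by rewrite tgt_map src_map e.
by rewrite /r (comp_map _ e1) (comp_map _ e').
Qed.
Definition smor_comp : strict_mor G K :=
  StrictMor smor_comp_src smor_comp_tgt smor_comp_unit smor_comp_comp.
End SmorComp.

Definition smor_iso (G H : groupoid) (f : strict_mor G H) : Prop :=
  exists g : strict_mor H G,
    smor_eq (smor_comp g f) (smor_id G) /\ smor_eq (smor_comp f g) (smor_id H).

Record nat_trans (G H : groupoid) (f g : strict_mor G H) := NatTrans {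
  nt_map :> Ob G -> Ar H;
  nt_src : forall a, src (nt_map a) = f a;
  nt_tgt : forall a, tgt (nt_map a) = g a;
  nt_nat : forall x (e : tgt (ar_map f x) = src (nt_map (tgt x)))
             (e' : tgt (nt_map (src x)) = src (ar_map g x)),
      comp (ar_map f x) (nt_map (tgt x)) e = comp (nt_map (src x)) (ar_map g x) e'
}.

Section HomMap.
Variables (G H : groupoid) (f : strict_mor G H) (a b : Ob G).
Fact hom_map_subproof (x : hom a b) :
  src (ar_map f (sval x)) = f a /\ tgt (ar_map f (sval x)) = f b.
Proof. by case: x => x /= [<- <-]; rewrite src_map tgt_map. Qed.
Definition hom_map (x : hom a b) : hom (f a) (f b) :=
  exist _ (ar_map f (sval x)) (hom_map_subproof x).
End HomMap.

Definition full_equivalence (K G : groupoid) (psi : strict_mor K G) : Prop :=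
  (forall c : Ob G, exists a : Ob K, psi a = c) /\
  (forall a b : Ob K, bijective (@hom_map K G psi a b)).

Section Lift.
Variables (K G : groupoid) (psi : strict_mor K G).
Hypothesis psiP : full_equivalence psi.

Fact full_equivalence_lift (a b : Ob K) (x : hom (psi a) (psi b)) :
  exists y : hom a b, hom_map psi y = x.
Proof. by case: (psiP.2 a b) => g _ gK; exists (g x); apply: gK. Qed.

(* (psi^1)^{-1}(x) : a -> b for x : psi^0(a) -> psi^0(b) *)
Definition lift (a b : Ob K) (x : Ar G) (es : src x = psi a)
    (et : tgt x = psi b) : Ar K :=
  sval (sval (cid (full_equivalence_lift
    (exist (fun z => src z = psi a /\ tgt z = psi b) x (conj es et))))).

Definition pick_ob (c : Ob G) : Ob K := sval (cid (psiP.1 c)).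

Lemma pick_obK (c : Ob G) : psi (pick_ob c) = c.
Proof. exact: proj2_sig (cid (psiP.1 c)). Qed.

Section LiftTheory.
Variables (a b : Ob K) (x : Ar G) (es : src x = psi a) (et : tgt x = psi b).
Lemma src_lift : src (lift es et) = a.
Proof. by rewrite /lift; case: (cid _) => [[y [/= ]]]. Qed.
Lemma tgt_lift : tgt (lift es et) = b.
Proof. by rewrite /lift; case: (cid _) => [[y [/= ]]]. Qed.
Lemma liftK : ar_map psi (lift es et) = x.
Proof. by rewrite /lift; case: (cid _) => y /= /(congr1 sval). Qed.
End LiftTheory.

Lemma full_equivalence_inj (y y' : Ar K) : src y = src y' -> tgt y = tgt y' ->
  ar_map psi y = ar_map psi y' -> y = y'.
Proof.
move=> es et ey; have [_ /(_ (src y) (tgt y)) [g fK _]] := psiP.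
pose h := exist (fun z => src z = src y /\ tgt z = tgt y) y (conj erefl erefl).
pose h' := exist (fun z => src z = src y /\ tgt z = tgt y) y'
  (conj (esym es) (esym et)).
suff /(congr1 sval) : h = h' by [].
by apply: (can_inj fK); apply: hom_eq.
Qed.

Lemma lift_unique (a b : Ob K) (x : Ar G) (es : src x = psi a)
    (et : tgt x = psi b) (y : Ar K) :
  src y = a -> tgt y = b -> ar_map psi y = x -> lift es et = y.
Proof.
by move=> ys yt yx; apply: full_equivalence_inj;
  rewrite ?src_lift ?tgt_lift ?liftK.
Qed.
End Lift.

Section FiberProduct.
Variables (G1 G2 H : groupoid) (f1 : strict_mor G1 H) (f2 : strict_mor G2 H).

Definition fp_ob : Type := {p : Ob G1 * Ob G2 | f1 p.1 = f2 p.2}.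
Definition fp_ar : Type := {p : Ar G1 * Ar G2 | ar_map f1 p.1 = ar_map f2 p.2}.

Definition fp_pair (a : Ob G1) (b : Ob G2) (e : f1 a = f2 b) : fp_ob :=
  exist (fun p => f1 p.1 = f2 p.2) (a, b) e.
Definition fp_arpair (x : Ar G1) (y : Ar G2) (e : ar_map f1 x = ar_map f2 y) :
    fp_ar :=
  exist (fun p => ar_map f1 p.1 = ar_map f2 p.2) (x, y) e.

Lemma fp_ob_eq (p q : fp_ob) :
  (sval p).1 = (sval q).1 -> (sval p).2 = (sval q).2 -> p = q.
Proof.
case: p q => [[a b] e] [[a' b'] e'] /= ea eb.
by apply: eq_exist; rewrite ea eb.
Qed.
Lemma fp_ar_eq (p q : fp_ar) :
  (sval p).1 = (sval q).1 -> (sval p).2 = (sval q).2 -> p = q.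
Proof.
case: p q => [[a b] e] [[a' b'] e'] /= ea eb.
by apply: eq_exist; rewrite ea eb.
Qed.

Fact fp_src_subproof (x : fp_ar) : f1 (src (sval x).1) = f2 (src (sval x).2).
Proof. by rewrite -!src_map (proj2_sig x). Qed.
Definition fp_src (x : fp_ar) : fp_ob := fp_pair (fp_src_subproof x).

Fact fp_tgt_subproof (x : fp_ar) : f1 (tgt (sval x).1) = f2 (tgt (sval x).2).
Proof. by rewrite -!tgt_map (proj2_sig x). Qed.
Definition fp_tgt (x : fp_ar) : fp_ob := fp_pair (fp_tgt_subproof x).

Section Comp.
Variables (x y : fp_ar) (e : fp_tgt x = fp_src y).
Fact fp_comp1 : tgt (sval x).1 = src (sval y).1.
Proof. exact: (congr1 (fun p => (sval p).1) e). Qed.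
Fact fp_comp2 : tgt (sval x).2 = src (sval y).2.
Proof. exact: (congr1 (fun p => (sval p).2) e). Qed.
Fact fp_comp_subproof :
  ar_map f1 (comp _ _ fp_comp1) = ar_map f2 (comp _ _ fp_comp2).
Proof.
have e1 : tgt (ar_map f1 (sval x).1) = src (ar_map f1 (sval y).1).
  by rewrite tgt_map src_map fp_comp1.
have e2 : tgt (ar_map f2 (sval x).2) = src (ar_map f2 (sval y).2).
  by rewrite tgt_map src_map fp_comp2.
rewrite (comp_map _ e1) (comp_map _ e2).
by apply: comp_eq; [apply: (proj2_sig x) | apply: (proj2_sig y)].
Qed.
Definition fp_comp : fp_ar := fp_arpair fp_comp_subproof.
End Comp.

Fact fp_unit_subproof (a : fp_ob) :
  ar_map f1 (unit_ar (sval a).1) = ar_map f2 (unit_ar (sval a).2).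
Proof. by rewrite !unit_map (proj2_sig a). Qed.
Definition fp_unit (a : fp_ob) : fp_ar := fp_arpair (fp_unit_subproof a).

End FiberProduct.

Lemma inv_map (G H : groupoid) (f : strict_mor G H) (x : Ar G) :
  ar_map f (inv_ar x) = inv_ar (ar_map f x).
Proof.
set y := ar_map f x; set z := ar_map f (inv_ar x).
have ezy : tgt z = src y by rewrite tgt_map tgt_inv src_map.
have eyi : tgt y = src (inv_ar y) by rewrite src_inv.
have ezi : tgt z = src (comp y (inv_ar y) eyi) by rewrite src_comp.
have e' : tgt (comp z y ezy) = src (inv_ar y) by rewrite tgt_comp.
have A := compA e' ezi.
have zy : comp z y ezy = unit_ar (tgt y).
  have ei : tgt (inv_ar x) = src x by rewrite tgt_inv.
  by rewrite /z /y -(comp_map ei) compVx unit_map tgt_map.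
have L : comp (comp z y ezy) (inv_ar y) e' = inv_ar y.
  have e2 : tgt (unit_ar (src (inv_ar y))) = src (inv_ar y) by rewrite tgt_unit.
  rewrite -[RHS](comp1x e2); apply: comp_eq => //.
  by rewrite zy src_inv.
have R : comp z (comp y (inv_ar y) eyi) ezi = z.
  have e2 : tgt z = src (unit_ar (tgt z)) by rewrite src_unit.
  rewrite -[RHS](compx1 e2); apply: comp_eq => //.
  by rewrite compxV ezy.
by rewrite -R -A L.
Qed.

Section FiberProductGroupoid.
Variables (G1 G2 H : groupoid) (f1 : strict_mor G1 H) (f2 : strict_mor G2 H).

Fact fp_inv_subproof (x : fp_ar f1 f2) :
  ar_map f1 (inv_ar (sval x).1) = ar_map f2 (inv_ar (sval x).2).
Proof. by rewrite !inv_map (proj2_sig x). Qed.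
Definition fp_inv (x : fp_ar f1 f2) : fp_ar f1 f2 :=
  fp_arpair (fp_inv_subproof x).

(* The strict fiber product of f1 and f2, with componentwise structure. *)
Definition fprod : groupoid.
Proof.
refine (@Groupoid (fp_ob f1 f2) (fp_ar f1 f2) (@fp_src _ _ _ f1 f2)
  (@fp_tgt _ _ _ f1 f2) (@fp_comp _ _ _ f1 f2) (@fp_unit _ _ _ f1 f2) fp_inv
  _ _ _ _ _ _ _ _ _ _ _).
- abstract by move=> x y e; apply: fp_ob_eq => /=; rewrite src_comp.
- abstract by move=> x y e; apply: fp_ob_eq => /=; rewrite tgt_comp.
- abstract by move=> a; apply: fp_ob_eq => /=; rewrite src_unit.
- abstract by move=> a; apply: fp_ob_eq => /=; rewrite tgt_unit.
- abstract by move=> x; apply: fp_ob_eq => /=; rewrite src_inv.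
- abstract by move=> x; apply: fp_ob_eq => /=; rewrite tgt_inv.
- abstract by move=> x y z exy eyz e e'; apply: fp_ar_eq; apply: compA.
- abstract by move=> x e; apply: fp_ar_eq; apply: comp1x.
- abstract by move=> x e; apply: fp_ar_eq; apply: compx1.
- abstract by move=> x e; apply: fp_ar_eq; apply: compxV.
- abstract by move=> x e; apply: fp_ar_eq; apply: compVx.
Defined.

Definition fproj1 : strict_mor fprod G1.
Proof.
refine (@StrictMor fprod G1 (fun p => (sval p).1) (fun x => (sval x).1)
  (fun=> erefl) (fun=> erefl) (fun=> erefl) _).
abstract by move=> x y e e'; apply: comp_eq.
Defined.

Definition fproj2 : strict_mor fprod G2.
Proof.
refine (@StrictMor fprod G2 (fun p => (sval p).2) (fun x => (sval x).2)
  (fun=> erefl) (fun=> erefl) (fun=> erefl) _).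
abstract by move=> x y e e'; apply: comp_eq.
Defined.
End FiberProductGroupoid.

Lemma full_equivalence_comp (K L G : groupoid) (phi : strict_mor L G)
    (psi : strict_mor K L) :
  full_equivalence phi -> full_equivalence psi ->
  full_equivalence (smor_comp phi psi).
Proof.
move=> [s1 b1] [s2 b2]; split=> [c|a b].
  by have [d <-] := s1 c; have [a <-] := s2 d; exists a.
have -> : @hom_map _ _ (smor_comp phi psi) a b =
    @hom_map _ _ phi (psi a) (psi b) \o @hom_map _ _ psi a b.
  by apply: funext => x; apply: hom_eq.
exact: bij_comp (b1 _ _) (b2 _ _).
Qed.

Lemma full_equivalence_fproj1 (G1 G2 H : groupoid) (f1 : strict_mor G1 H)
    (f2 : strict_mor G2 H) :
  full_equivalence f2 -> full_equivalence (fproj1 f1 f2).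
Proof.
move=> f2P; split=> [c|a b].
  have e : f1 c = f2 (pick_ob f2P (f1 c)) by rewrite pick_obK.
  by exists (fp_pair e).
have es (x : hom (fproj1 f1 f2 a) (fproj1 f1 f2 b)) :
    src (ar_map f1 (sval x)) = f2 (fproj2 f1 f2 a).
  by rewrite src_map (proj2_sig x).1 /= (proj2_sig a).
have et (x : hom (fproj1 f1 f2 a) (fproj1 f1 f2 b)) :
    tgt (ar_map f1 (sval x)) = f2 (fproj2 f1 f2 b).
  by rewrite tgt_map (proj2_sig x).2 /= (proj2_sig b).
have el x : ar_map f1 (sval x) = ar_map f2 (lift f2P (es x) (et x)).
  by rewrite liftK.
have eh x : src (g := fprod f1 f2) (fp_arpair (el x)) = a /\
            tgt (g := fprod f1 f2) (fp_arpair (el x)) = b.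
  split; apply: fp_ob_eq => /=; rewrite ?src_lift ?tgt_lift //.
    exact: (proj2_sig x).1.
  exact: (proj2_sig x).2.
exists (fun x => exist _ (fp_arpair (el x)) (eh x)) => x; apply: hom_eq => //=.
apply: fp_ar_eq => //=; apply: lift_unique.
- exact: (congr1 (fun p => (sval p).2) (proj2_sig x).1).
- exact: (congr1 (fun p => (sval p).2) (proj2_sig x).2).
- exact: (esym (proj2_sig (sval x))).
Qed.

(* The canonical isomorphism (I x_H J) x_N K -> I x_H (J x_N K) *)
Section Rebracket.
Variables (I H J N K : groupoid) (f : strict_mor I H) (p : strict_mor J H)
  (g : strict_mor J N) (q : strict_mor K N).
Let dom := fprod (smor_comp g (fproj2 f p)) q.
Let cod := fprod f (smor_comp p (fproj1 g q)).

Definition rebracket_ob (a : Ob dom) : Ob cod :=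
  let ij := (sval a).1 in
  @fp_pair _ _ _ f (smor_comp p (fproj1 g q)) (sval ij).1
    (@fp_pair _ _ _ g q (sval ij).2 (sval a).2 (proj2_sig a)) (proj2_sig ij).

Definition rebracket_ar (x : Ar dom) : Ar cod :=
  let ij := (sval x).1 in
  @fp_arpair _ _ _ f (smor_comp p (fproj1 g q)) (sval ij).1
    (@fp_arpair _ _ _ g q (sval ij).2 (sval x).2 (proj2_sig x)) (proj2_sig ij).

Definition rebracket : strict_mor dom cod.
Proof.
refine (@StrictMor dom cod rebracket_ob rebracket_ar _ _ _ _).
- abstract by move=> x; do 2?[apply: fp_ob_eq => //=].
- abstract by move=> x; do 2?[apply: fp_ob_eq => //=].
- abstract by move=> a; do 2?[apply: fp_ar_eq => //=].
- abstract by move=> x y e e'; do 2?[apply: fp_ar_eq => /=]; apply: comp_eq.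
Defined.
End Rebracket.

Record full_mor (G H : groupoid) := FullMor {
  fm_gpd : groupoid;
  fm_eqv : strict_mor fm_gpd G;
  fm_eqvP : full_equivalence fm_eqv;
  fm_leg : strict_mor fm_gpd H
}.

(* FMor^1(G,H), with source A1 and target A2 *)
Definition fmor_ar (G H : groupoid) (A1 A2 : full_mor G H) : Type :=
  nat_trans (smor_comp (fm_leg A1) (fproj1 (fm_eqv A1) (fm_eqv A2)))
            (smor_comp (fm_leg A2) (fproj2 (fm_eqv A1) (fm_eqv A2))).

Section FullComp.
Variables (G H N : groupoid) (A : full_mor G H) (B : full_mor H N).

(* first A, then B *)
Definition fcomp : full_mor G N :=
  @FullMor G N (fprod (fm_leg A) (fm_eqv B))
    (smor_comp (fm_eqv A) (fproj1 (fm_leg A) (fm_eqv B)))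
    (full_equivalence_comp (fm_eqvP A)
      (full_equivalence_fproj1 (fm_leg A) (fm_eqvP B)))
    (smor_comp (fm_leg B) (fproj2 (fm_leg A) (fm_eqv B))).
End FullComp.

Section HorizontalComposition.
Variables (G H N : groupoid) (A1 A2 : full_mor G H) (B1 B2 : full_mor H N).
Variables (beta : fmor_ar B1 B2) (alpha : fmor_ar A1 A2).

Section Value.
Variables (k1 : Ob (fm_gpd A1)) (j1 : Ob (fm_gpd B1)).
Variables (k2 : Ob (fm_gpd A2)) (j2 : Ob (fm_gpd B2)).
Hypotheses (e1 : fm_leg A1 k1 = fm_eqv B1 j1).
Hypotheses (e2 : fm_leg A2 k2 = fm_eqv B2 j2).
Hypothesis (e12 : fm_eqv A1 k1 = fm_eqv A2 k2).

Section Choice12.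
Variables (j12 : Ob (fm_gpd B2)) (ej12 : fm_eqv B1 j1 = fm_eqv B2 j12).

Fact hval_src : src (alpha (fp_pair e12)) = fm_eqv B2 j12.
Proof. by rewrite nt_src /= e1. Qed.
Fact hval_tgt : tgt (alpha (fp_pair e12)) = fm_eqv B2 j2.
Proof. by rewrite nt_tgt /= e2. Qed.

(* y_alpha *)
Definition hlift : Ar (fm_gpd B2) := lift (fm_eqvP B2) hval_src hval_tgt.

Fact hval_comp : tgt (beta (fp_pair ej12)) = src (ar_map (fm_leg B2) hlift).
Proof. by rewrite nt_tgt src_map src_lift. Qed.

(* beta(j1, j12) . v2(y_alpha), for a given choice of j12 *)
Definition hval : Ar N := comp _ _ hval_comp.
End Choice12.

Section Choice21.
Variables (j21 : Ob (fm_gpd B1)) (ej21 : fm_eqv B1 j21 = fm_eqv B2 j2).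

Fact hval'_src : src (alpha (fp_pair e12)) = fm_eqv B1 j1.
Proof. by rewrite nt_src /= e1. Qed.
Fact hval'_tgt : tgt (alpha (fp_pair e12)) = fm_eqv B1 j21.
Proof. by rewrite nt_tgt /= e2. Qed.

(* x_alpha *)
Definition hlift' : Ar (fm_gpd B1) := lift (fm_eqvP B1) hval'_src hval'_tgt.

Fact hval'_comp : tgt (ar_map (fm_leg B1) hlift') = src (beta (fp_pair ej21)).
Proof. by rewrite nt_src tgt_map tgt_lift. Qed.

(* v1(x_alpha) . beta(j21, j2), for a given choice of j21 *)
Definition hval' : Ar N := comp _ _ hval'_comp.
End Choice21.

(* Naturality of beta at (x_alpha, y_alpha). *)
Lemma hval_hval' j12 (ej12 : fm_eqv B1 j1 = fm_eqv B2 j12)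
    j21 (ej21 : fm_eqv B1 j21 = fm_eqv B2 j2) : hval ej12 = hval' ej21.
Proof.
have exy : ar_map (fm_eqv B1) (hlift' ej21) = ar_map (fm_eqv B2) (hlift ej12).
  by rewrite !liftK.
pose z : Ar (fprod (fm_eqv B1) (fm_eqv B2)) := fp_arpair exy.
have zs : src z = fp_pair ej12 by apply: fp_ob_eq; rewrite /= src_lift.
have zt : tgt z = fp_pair ej21 by apply: fp_ob_eq; rewrite /= tgt_lift.
have q1 : tgt (ar_map (smor_comp (fm_leg B1) (fproj1 (fm_eqv B1) (fm_eqv B2))) z)
   = src (beta (tgt z)) by rewrite nt_src tgt_map.
have q2 : tgt (beta (src z)) =
   src (ar_map (smor_comp (fm_leg B2) (fproj2 (fm_eqv B1) (fm_eqv B2))) z).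
  by rewrite nt_tgt src_map.
have := nt_nat q1 q2.
rewrite (comp_eq q1 (hval'_comp ej21)) // ?zt //.
by rewrite (comp_eq q2 (hval_comp ej12)) // ?zs.
Qed.

Lemma src_hval j12 (ej12 : fm_eqv B1 j1 = fm_eqv B2 j12) :
  src (hval ej12) = fm_leg B1 j1.
Proof. by rewrite src_comp nt_src. Qed.
Lemma tgt_hval j12 (ej12 : fm_eqv B1 j1 = fm_eqv B2 j12) :
  tgt (hval ej12) = fm_leg B2 j2.
Proof. by rewrite tgt_comp tgt_map tgt_lift. Qed.
End Value.

Lemma hval_indep k1 j1 k2 j2 e1 e2 e12 j12 ej12 j12' ej12' :
  @hval k1 j1 k2 j2 e1 e2 e12 j12 ej12 = @hval k1 j1 k2 j2 e1 e2 e12 j12' ej12'.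
Proof.
have ej21 := pick_obK (fm_eqvP B1) (fm_eqv B2 j2).
by rewrite !(hval_hval' _ _ _ _ ej21).
Qed.

Fact hcomp_choice (j1 : Ob (fm_gpd B1)) :
  fm_eqv B1 j1 = fm_eqv B2 (pick_ob (fm_eqvP B2) (fm_eqv B1 j1)).
Proof. by rewrite pick_obK. Qed.

Definition hcomp_map
    (p : Ob (fprod (fm_eqv (fcomp A1 B1)) (fm_eqv (fcomp A2 B2)))) : Ar N :=
  let p1 : Ob (fm_gpd (fcomp A1 B1)) := (sval p).1 in
  let p2 : Ob (fm_gpd (fcomp A2 B2)) := (sval p).2 in
  @hval (sval p1).1 (sval p1).2 (sval p2).1 (sval p2).2
    (proj2_sig p1) (proj2_sig p2) (proj2_sig p) _ (hcomp_choice (sval p1).2).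

Fact hcomp_src p :
  src (hcomp_map p) =
  smor_comp (fm_leg (fcomp A1 B1))
    (fproj1 (fm_eqv (fcomp A1 B1)) (fm_eqv (fcomp A2 B2))) p.
Proof. exact: src_hval. Qed.

Fact hcomp_tgt p :
  tgt (hcomp_map p) =
  smor_comp (fm_leg (fcomp A2 B2))
    (fproj2 (fm_eqv (fcomp A1 B1)) (fm_eqv (fcomp A2 B2))) p.
Proof. exact: tgt_hval. Qed.

Let src_leg := smor_comp (fm_leg (fcomp A1 B1))
  (fproj1 (fm_eqv (fcomp A1 B1)) (fm_eqv (fcomp A2 B2))).
Let tgt_leg := smor_comp (fm_leg (fcomp A2 B2))
  (fproj2 (fm_eqv (fcomp A1 B1)) (fm_eqv (fcomp A2 B2))).

Fact hcomp_nat X (e : tgt (ar_map src_leg X) = src (hcomp_map (tgt X)))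
    (e' : tgt (hcomp_map (src X)) = src (ar_map tgt_leg X)) :
  comp (ar_map src_leg X) (hcomp_map (tgt X)) e =
  comp (hcomp_map (src X)) (ar_map tgt_leg X) e'.
Proof.
pose P := fprod (fm_eqv B1) (fm_eqv B2).
pose x1 := (sval (sval X).1).1; pose y1 := (sval (sval X).1).2.
pose x2 := (sval (sval X).2).1; pose y2 := (sval (sval X).2).2.
have E1 : ar_map (fm_leg A1) x1 = ar_map (fm_eqv B1) y1 := proj2_sig (sval X).1.
have E2 : ar_map (fm_leg A2) x2 = ar_map (fm_eqv B2) y2 := proj2_sig (sval X).2.
have E12 : ar_map (fm_eqv A1) x1 = ar_map (fm_eqv A2) x2 := proj2_sig X.
move: e e'; rewrite /hcomp_map /hval.
set b' := beta _; set hy' := hlift _ _ _ _ => e.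
set b := beta _; set hy := hlift _ _ _ _ => e'.
pose j12 := pick_ob (fm_eqvP B2) (fm_eqv B1 (src y1)).
pose j12' := pick_ob (fm_eqvP B2) (fm_eqv B1 (tgt y1)).
have ts : src (ar_map (fm_eqv B1) y1) = fm_eqv B2 j12.
  by rewrite src_map pick_obK.
have tt : tgt (ar_map (fm_eqv B1) y1) = fm_eqv B2 j12'.
  by rewrite tgt_map pick_obK.
pose t := lift (fm_eqvP B2) ts tt.
have Et : ar_map (fm_eqv B1) y1 = ar_map (fm_eqv B2) t by rewrite liftK.
pose z : Ar P := fp_arpair Et.
have zs : beta (src z) = b.
  by congr (nt_map _ _); apply: fp_ob_eq; rewrite /= ?src_lift.
have zt : beta (tgt z) = b'.
  by congr (nt_map _ _); apply: fp_ob_eq; rewrite /= ?tgt_lift.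
have n1 : tgt (ar_map (fm_leg B1) y1) = src b'.
  by rewrite -zt nt_src tgt_map.
have n2 : tgt b = src (ar_map (fm_leg B2) t).
  by rewrite -zs nt_tgt src_map.
have natz : comp _ _ n1 = comp _ _ n2.
  have m1 : tgt (ar_map (smor_comp (fm_leg B1) (fproj1 (fm_eqv B1) (fm_eqv B2)))
    z) = src (beta (tgt z)) by rewrite nt_src tgt_map.
  have m2 : tgt (beta (src z)) =
    src (ar_map (smor_comp (fm_leg B2) (fproj2 (fm_eqv B1) (fm_eqv B2))) z).
    by rewrite nt_tgt src_map.
  by have := nt_nat m1 m2; rewrite (comp_eq m1 n1) // (comp_eq m2 n2).
have hs : src hy = j12 by rewrite src_lift.
have ht : tgt hy = src y2 by rewrite tgt_lift.
have hs' : src hy' = j12' by rewrite src_lift.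
have ht' : tgt hy' = tgt y2 by rewrite tgt_lift.
have c1 : tgt t = src hy' by rewrite tgt_lift hs'.
have c2 : tgt hy = src y2 by rewrite ht.
have square : comp _ _ c1 = comp _ _ c2.
  apply: (full_equivalence_inj (fm_eqvP B2)).
  - by rewrite !src_comp hs src_lift.
  - by rewrite !tgt_comp ht'.
  have d1 : tgt (ar_map (fm_eqv B2) t) = src (ar_map (fm_eqv B2) hy').
    by rewrite tgt_map src_map c1.
  have d2 : tgt (ar_map (fm_eqv B2) hy) = src (ar_map (fm_eqv B2) y2).
    by rewrite tgt_map src_map c2.
  rewrite (comp_map _ d1) (comp_map _ d2).
  pose w : Ar (fprod (fm_eqv A1) (fm_eqv A2)) := fp_arpair E12.
  have m1 : tgt (ar_map (smor_comp (fm_leg A1) (fproj1 (fm_eqv A1) (fm_eqv A2)))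
    w) = src (alpha (tgt w)) by rewrite nt_src tgt_map.
  have m2 : tgt (alpha (src w)) =
    src (ar_map (smor_comp (fm_leg A2) (fproj2 (fm_eqv A1) (fm_eqv A2))) w).
    by rewrite nt_tgt src_map.
  have := nt_nat m1 m2.
  rewrite (comp_eq m1 d1) ?(comp_eq m2 d2) //.
  - by rewrite liftK; congr (nt_map _ _); apply: fp_ob_eq.
  - by rewrite /= E1 Et.
  - by rewrite liftK; congr (nt_map _ _); apply: fp_ob_eq.
have f1 : tgt (ar_map (fm_leg B2) t) = src (ar_map (fm_leg B2) hy').
  by rewrite tgt_map src_map c1.
have f2 : tgt (ar_map (fm_leg B2) hy) = src (ar_map (fm_leg B2) y2).
  by rewrite tgt_map src_map c2.
have sq2 : comp _ _ f1 = comp _ _ f2.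
  by rewrite -(comp_map c1) -(comp_map c2) square.
(* v1(y1) (b' hy') = (v1(y1) b') hy' = (b v2(t)) hy' = b (v2(t) v2(hy'))
   = b (v2(hy) v2(y2)) = (b v2(hy)) v2(y2) *)
have g1 : tgt (comp _ _ n1) = src (ar_map (fm_leg B2) hy').
  by rewrite tgt_comp /b' nt_tgt /= src_map hs'.
have bh' : tgt b' = src (ar_map (fm_leg B2) hy').
  by rewrite /b' nt_tgt /= src_map hs'.
have bh : tgt b = src (ar_map (fm_leg B2) hy).
  by rewrite /b nt_tgt /= src_map hs.
have k1 : tgt (ar_map (fm_leg B1) y1) = src (comp _ _ bh').
  by rewrite src_comp.
have k2 : tgt (comp _ _ bh) = src (ar_map (fm_leg B2) y2).
  by rewrite tgt_comp.
have k3 : tgt b = src (comp _ _ f2) by rewrite src_comp.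
have k4 : tgt b = src (comp _ _ f1) by rewrite sq2.
have g2 : tgt (comp _ _ n2) = src (ar_map (fm_leg B2) hy').
  by rewrite -natz.
transitivity (comp _ _ k1); first by do 2?apply: comp_eq.
rewrite -(compA g1 k1).
transitivity (comp _ _ g2); first exact: comp_eq.
rewrite (compA g2 k4).
transitivity (comp _ _ k3); first exact: comp_eq.
rewrite -(compA k2 k3).
by do 2?apply: comp_eq.
Qed.

(* beta ~o alpha *)
Definition hcomp : fmor_ar (fcomp A1 B1) (fcomp A2 B2) :=
  @NatTrans _ _ src_leg tgt_leg hcomp_map hcomp_src hcomp_tgt hcomp_nat.

Lemma hcompE k1 j1 k2 j2 (e1 : fm_leg A1 k1 = fm_eqv B1 j1)
    (e2 : fm_leg A2 k2 = fm_eqv B2 j2)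
    (e : fm_eqv (fcomp A1 B1) (fp_pair e1) = fm_eqv (fcomp A2 B2) (fp_pair e2)) :
  (forall j12 (ej12 : fm_eqv B1 j1 = fm_eqv B2 j12),
     hcomp (fp_pair e) = hval e1 e2 e ej12) /\
  (forall j21 (ej21 : fm_eqv B1 j21 = fm_eqv B2 j2),
     hcomp (fp_pair e) = hval' e1 e2 e ej21).
Proof.
split=> [j12 ej12|j21 ej21].
  exact: (@hval_indep _ _ _ _ e1 e2 e _ (hcomp_choice j1) _ ej12).
exact: (hval_hval' e1 e2 e (hcomp_choice j1) ej21).
Qed.
End HorizontalComposition.

(* theta is an isomorphism of the groupoids underlying A and B that
   intertwines both legs. *)
Definition identifies (G H : groupoid) (A B : full_mor G H)
    (theta : strict_mor (fm_gpd A) (fm_gpd B)) : Prop :=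
  [/\ smor_iso theta,
      smor_eq (smor_comp (fm_eqv B) theta) (fm_eqv A) &
      smor_eq (smor_comp (fm_leg B) theta) (fm_leg A)].
Arguments identifies {G H} A B theta.

(* alpha : A1 -> A2 and beta : B1 -> B2 coincide under theta1 : A1 -> B1 and
   theta2 : A2 -> B2: every object (k1, k2) of the fiber product on which alpha
   is defined is sent by theta1 x theta2 to one on which beta is defined, and
   the two values agree. *)
Definition coincide_under (G H : groupoid) (A1 A2 B1 B2 : full_mor G H)
    (theta1 : strict_mor (fm_gpd A1) (fm_gpd B1))
    (theta2 : strict_mor (fm_gpd A2) (fm_gpd B2))
    (alpha : fmor_ar A1 A2) (beta : fmor_ar B1 B2) : Prop :=
  forall (k1 : Ob (fm_gpd A1)) (k2 : Ob (fm_gpd A2))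
         (e : fm_eqv A1 k1 = fm_eqv A2 k2),
    exists e' : fm_eqv B1 (theta1 k1) = fm_eqv B2 (theta2 k2),
      alpha (fp_pair e) = beta (fp_pair e').
Arguments coincide_under {G H A1 A2 B1 B2} theta1 theta2 alpha beta.

Definition fcompA (G H N M : groupoid) (A : full_mor G H) (B : full_mor H N)
    (C : full_mor N M) :
    strict_mor (fm_gpd (fcomp (fcomp A B) C)) (fm_gpd (fcomp A (fcomp B C))) :=
  rebracket (fm_leg A) (fm_eqv B) (fm_leg B) (fm_eqv C).

(* Main.v *)
Require Import Defs.
From mathcomp Require Import ssreflect ssrfun ssrbool boolp.

(** On full-morphisms, both legs of either iterated composite of A, B, C are
    the outer legs of A and C applied to the outer components, and rebracketing
    a triple moves no component; it is inverted by the opposite rebracketing.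

    For arrows, the value of [hcomp beta alpha] at $(k_1,j_1;k_2,j_2)$ is
    $\beta(j_1,s)\cdot v_2(y)$ for any arrow $y : s \to j_2$ lying over
    $\alpha(k_1,k_2)$ ([hcomp_val]).  Take the object $(i_1,j_1,k_1;i_2,j_2,k_2)$
    and write $v_2$, $w_2$ for the legs of the targets of $\alpha_2$,
    $\alpha_3$.  Choose an arrow $(y,z) : (j',k') \to (j_2,k_2)$ over
    $\alpha_1(i_1,i_2)$, so that $y$ lies over $\alpha_1(i_1,i_2)$ and $z$ over
    $v_2(y)$, and then $t : k'' \to k'$ over $\alpha_2(j_1,j')$.

    Evaluating $(\alpha_3\circ\alpha_2)\circ\alpha_1$ along $(y,z)$, and
    $\alpha_3\circ\alpha_2$ along $t$, gives
    $(\alpha_3(k_1,k'')\cdot w_2(t))\cdot w_2(z)$.  On the other side $t\cdot z$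
    lies over $\alpha_2(j_1,j')\cdot v_2(y)$, which is the value of
    $\alpha_2\circ\alpha_1$ along $y$; so $\alpha_3\circ(\alpha_2\circ\alpha_1)$
    evaluated along $t\cdot z$ is $\alpha_3(k_1,k'')\cdot w_2(t\cdot z)$.  The two
    agree since $w_2$ is a functor and composition in M is associative ([hcompA]). *)

Set Implicit Arguments.
Unset Strict Implicit.
Unset Printing Implicit Defensive.

(* Composition of arrows; the bare name denotes composition of functions here. *)
Local Notation comp := Defs.comp.

Section RebracketInverse.
Variables (I H J N K : groupoid) (f : strict_mor I H) (p : strict_mor J H)
  (g : strict_mor J N) (q : strict_mor K N).
Let dom := fprod (smor_comp g (fproj2 f p)) q.
Let cod := fprod f (smor_comp p (fproj1 g q)).

Definition unrebracket_ob (a : Ob cod) : Ob dom :=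
  let jk := (sval a).2 in
  @fp_pair _ _ _ (smor_comp g (fproj2 f p)) q
    (@fp_pair _ _ _ f p (sval a).1 (sval jk).1 (proj2_sig a))
    (sval jk).2 (proj2_sig jk).

Definition unrebracket_ar (x : Ar cod) : Ar dom :=
  let jk := (sval x).2 in
  @fp_arpair _ _ _ (smor_comp g (fproj2 f p)) q
    (@fp_arpair _ _ _ f p (sval x).1 (sval jk).1 (proj2_sig x))
    (sval jk).2 (proj2_sig jk).

Definition unrebracket : strict_mor cod dom.
Proof.
refine (@StrictMor cod dom unrebracket_ob unrebracket_ar _ _ _ _).
- abstract by move=> x; do 2?[apply: fp_ob_eq => //=].
- abstract by move=> x; do 2?[apply: fp_ob_eq => //=].
- abstract by move=> a; do 2?[apply: fp_ar_eq => //=].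
- abstract by move=> x y e e'; do 2?[apply: fp_ar_eq => /=]; apply: comp_eq.
Defined.

Lemma rebracket_iso : smor_iso (rebracket f p g q).
Proof.
exists unrebracket; split; split=> a /=.
- by do 2?[apply: fp_ob_eq => //=].
- by do 2?[apply: fp_ar_eq => //=].
- by do 2?[apply: fp_ob_eq => //=].
- by do 2?[apply: fp_ar_eq => //=].
Qed.
End RebracketInverse.

Lemma fcompA_identifies (G H N M : groupoid) (A : full_mor G H)
    (B : full_mor H N) (C : full_mor N M) :
  identifies (fcomp (fcomp A B) C) (fcomp A (fcomp B C)) (fcompA A B C).
Proof. by split=> //; apply: rebracket_iso. Qed.

(** Surjectivity on objects supplies the source, so only the target needs to
    be prescribed for an arrow to lift. *)
Lemma full_equivalence_arrow_to (K G : groupoid) (psi : strict_mor K G) (x : Ar G)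
    (b : Ob K) :
  full_equivalence psi -> tgt x = psi b ->
  exists y : Ar K, tgt y = b /\ ar_map psi y = x.
Proof.
move=> psiP et; have es := esym (pick_obK psiP (src x)).
by exists (lift psiP es et); rewrite tgt_lift liftK.
Qed.

(** Since $\phi_2$ is a full-equivalence, an arrow over $\alpha(k_1,k_2)$ that
    ends at $j_2$ is the lift of $\alpha(k_1,k_2)$ from its own source, and the
    horizontal composite does not depend on the auxiliary object.  Evaluating
    along an arbitrary such arrow removes chosen lifts from the computations. *)
Lemma hcomp_val (G H N : groupoid) (A1 A2 : full_mor G H) (B1 B2 : full_mor H N)
    (beta : fmor_ar B1 B2) (alpha : fmor_ar A1 A2) k1 j1 k2 j2
    (e1 : fm_leg A1 k1 = fm_eqv B1 j1) (e2 : fm_leg A2 k2 = fm_eqv B2 j2)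
    (e : fm_eqv (fcomp A1 B1) (fp_pair e1) = fm_eqv (fcomp A2 B2) (fp_pair e2))
    (y : Ar (fm_gpd B2)) (ej : fm_eqv B1 j1 = fm_eqv B2 (src y))
    (c : tgt (beta (fp_pair ej)) = src (ar_map (fm_leg B2) y)) :
  tgt y = j2 ->
  ar_map (fm_eqv B2) y = alpha (fp_pair (e : fm_eqv A1 k1 = fm_eqv A2 k2)) ->
  hcomp beta alpha (fp_pair e) = comp (beta (fp_pair ej)) (ar_map (fm_leg B2) y) c.
Proof.
move=> ty ay; rewrite ((hcompE beta alpha e).1 _ ej).
by apply: comp_eq => //; congr (ar_map _ _); apply: lift_unique.
Qed.

Lemma hcompA (G H N M : groupoid)
    (A1 A2 : full_mor G H) (B1 B2 : full_mor H N) (C1 C2 : full_mor N M)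
    (alpha1 : fmor_ar A1 A2) (alpha2 : fmor_ar B1 B2) (alpha3 : fmor_ar C1 C2) :
  coincide_under (fcompA A1 B1 C1) (fcompA A2 B2 C2)
    (hcomp alpha3 (hcomp alpha2 alpha1)) (hcomp (hcomp alpha3 alpha2) alpha1).
Proof.
move=> [[[[i1 j1] /= e1] k1] /= f1] [[[[i2 j2] /= e2] k2] /= f2] /= e.
exists e.
pose jk2 : Ob (fm_gpd (fcomp B2 C2)) := fp_pair (f2 : fm_leg B2 j2 = fm_eqv C2 k2).
have et1 : tgt (alpha1 (fp_pair e)) = fm_eqv (fcomp B2 C2) jk2.
  by rewrite nt_tgt.
(* Lifting to the composite B2, C2 yields compatible lifts y and z at once. *)
have [yz [yzt yzP]] := full_equivalence_arrow_to (fm_eqvP (fcomp B2 C2)) et1.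
pose y := (sval yz).1; pose z := (sval yz).2.
have vyz : ar_map (fm_leg B2) y = ar_map (fm_eqv C2) z := proj2_sig yz.
have yt : tgt y = j2 := congr1 (fun q => (sval q).1) yzt.
have zt : tgt z = k2 := congr1 (fun q => (sval q).2) yzt.
have yP : ar_map (fm_eqv B2) y = alpha1 (fp_pair e) := yzP.
have ej : fm_eqv B1 j1 = fm_eqv B2 (src y).
  by rewrite -src_map yP nt_src /= e1.
have et2 : tgt (alpha2 (fp_pair ej)) = fm_eqv C2 (src z).
  by rewrite nt_tgt /= -!src_map vyz.
have [t [ctz tP]] := full_equivalence_arrow_to (fm_eqvP C2) et2.
have ek : fm_eqv C1 k1 = fm_eqv C2 (src t).
  by rewrite -src_map tP nt_src.
have c3t : tgt (alpha3 (fp_pair ek)) = src (ar_map (fm_leg C2) t).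
  by rewrite nt_tgt src_map.
have wtz : tgt (ar_map (fm_leg C2) t) = src (ar_map (fm_leg C2) z).
  by rewrite tgt_map src_map ctz.
have c3tz : tgt (comp _ _ c3t) = src (ar_map (fm_leg C2) z) by rewrite tgt_comp.
have c3tz' : tgt (alpha3 (fp_pair ek)) = src (comp _ _ wtz) by rewrite src_comp.
transitivity (comp _ _ c3tz').
  (* t . z lies over the value of the composite of alpha1 and alpha2 *)
  have es : fm_eqv C1 k1 = fm_eqv C2 (src (comp t z ctz)) by rewrite src_comp.
  have c : tgt (alpha3 (fp_pair es)) = src (ar_map (fm_leg C2) (comp t z ctz)).
    by rewrite nt_tgt src_map.
  have c2 : tgt (alpha2 (fp_pair ej)) = src (ar_map (fm_leg B2) y).
    by rewrite nt_tgt src_map.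
  have d : tgt (ar_map (fm_eqv C2) t) = src (ar_map (fm_eqv C2) z).
    by rewrite tgt_map src_map ctz.
  have tzP : ar_map (fm_eqv C2) (comp t z ctz) =
             hcomp alpha2 alpha1 (@fp_pair _ _ _ (fm_eqv (fcomp A1 B1))
               (fm_eqv (fcomp A2 B2)) (fp_pair e1) (fp_pair e2) e).
    by rewrite (hcomp_val c2 yt yP) (comp_map _ d); apply: comp_eq.
  etransitivity; first by apply: (hcomp_val c) tzP; rewrite tgt_comp.
  apply: comp_eq; last exact: comp_map.
  by congr (nt_map _ _); apply: fp_ob_eq; rewrite /= ?src_comp.
rewrite -(Defs.compA c3tz).
(* The other bracketing is evaluated along yz = (y, z). *)
pose ejk : fm_eqv (fcomp B1 C1) (fp_pair f1) = fm_eqv (fcomp B2 C2) (src yz) := ej.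
have inner : hcomp alpha3 alpha2 (fp_pair ejk) = comp _ _ c3t.
  exact: (hcomp_val (e := ejk) c3t ctz tP).
have c : tgt (hcomp alpha3 alpha2 (fp_pair ejk)) =
         src (ar_map (fm_leg (fcomp B2 C2)) yz) by rewrite nt_tgt src_map.
symmetry; etransitivity; first exact: (hcomp_val c) yzt yzP.
exact: comp_eq.
Qed.

Theorem lemma4p10 (G H N M : groupoid) :
  (forall (A : full_mor G H) (B : full_mor H N) (C : full_mor N M),
     identifies (fcomp (fcomp A B) C) (fcomp A (fcomp B C)) (fcompA A B C))
  /\
  (forall (A1 A2 : full_mor G H) (B1 B2 : full_mor H N) (C1 C2 : full_mor N M)
          (alpha1 : fmor_ar A1 A2) (alpha2 : fmor_ar B1 B2)
          (alpha3 : fmor_ar C1 C2),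
     coincide_under (fcompA A1 B1 C1) (fcompA A2 B2 C2)
       (hcomp alpha3 (hcomp alpha2 alpha1))
       (hcomp (hcomp alpha3 alpha2) alpha1)).
Proof. by split=> *; [apply: fcompA_identifies | apply: hcompA]. Qed.
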